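(* Let $\lambda\in[0,1]$, let $m,M$ be real numbers with $m>0$, and let $A$ and $B$ be invertible positive operators on a complex Hilbert space $\mathcal{H}$ satisfying $mI\leq A\leq B\leq MI\leq I$. Put $h=\frac{M}{m}$. Then the following operator inequalities hold. (i) (Ratio-type reverse inequality) $$A\sharp_{\lambda}B\leq(1-\lambda)A+\lambda B\leq\exp\left(\lambda(1-\lambda)(1-h)^2\right)A\sharp_{\lambda}B.$$ (ii) (Difference-type reverse inequality) $$A\sharp_{\lambda}B\leq(1-\lambda)A+\lambda B\leq A\sharp_{\lambda}B+\lambda(1-\lambda)(\log h)^2B.$$
   Context: Operators are bounded linear operators on a complex Hilbert space $\mathcal{H}$, and $I$ is the identity operator. A self-adjoint operator $A$ (i.e. $A=A^*$) is called positive if $\langle x, Ax\rangle\geq 0$ for all $x\in\mathcal{H}$; for self-adjoint operators, $A\geq B$ means that $A-B$ is positive. For invertible positive operators $A,B$ and $\lambda\in[0,1]$, the weighted geometric mean is $A\sharp_{\lambda}B=A^{1/2}\left(A^{-1/2}BA^{-1/2}\right)^{\lambda}A^{1/2}$, with powers defined by the continuous functional calculus; $\log$ is the natural logarithm. *)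

(* Defs.v *)
From mathcomp Require Import all_boot all_order all_algebra.
From mathcomp Require Import all_classical all_reals all_analysis.
From mathcomp Require Export complex.

Set Implicit Arguments.
Unset Strict Implicit.
Unset Printing Implicit Defensive.

Import Order.TTheory GRing.Theory Num.Theory.
Import numFieldNormedType.Exports.

Local Open Scope classical_set_scope.
Local Open Scope ring_scope.
Local Open Scope complex_scope.

(* Operators are functions [H -> H] with the pointwise module structure of
   [mathcomp.classical.functions]; products are written [A \o B] and the
   identity operator is [idfun]. *)

Section Operators.
Context {R : realType} {H : completeNormedModType R[i]}.
Implicit Types A B S T : H -> H.

Definition bounded_operator A :=
  linear A /\ exists k : R, forall x, `|A x| <= k%:C * `|x|.

Definition invertible A := exists S,
  [/\ bounded_operator S, A \o S = idfun & S \o A = idfun].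

Definition spectrum A : set R[i] :=
  [set z | ~ invertible (A - z *: idfun)].

Definition poly_op (p : {poly R[i]}) A : H -> H :=
  fun x => \sum_(k < size p) p`_k *: iter k A x.

(* [T] is [f(A)] in the continuous functional calculus: the limit in operator
   norm of [p_n(A)] for polynomials [p_n] that converge to [f] uniformly on the
   spectrum.  For self-adjoint [A] and [f] continuous on the spectrum there is
   exactly one such [T]. *)
Definition is_cfc A (f : R[i] -> R[i]) T :=
  bounded_operator T /\
  exists p : nat -> {poly R[i]},
    (forall e : R, 0 < e -> \forall n \near \oo,
       forall z, spectrum A z -> `|(p n).[z] - f z| <= e%:C) /\
    (forall e : R, 0 < e -> \forall n \near \oo,
       forall x, `|poly_op (p n) A x - T x| <= e%:C * `|x|).

Definition cfc A (f : R[i] -> R[i]) : H -> H := get (is_cfc A f).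

(* The spectrum of an invertible positive operator consists of positive real
   numbers, so only the values of the function on these matter. *)
Definition op_powR A (a : R) : H -> H :=
  cfc A (fun z => (complex.Re z `^ a)%:C).

Definition geometric_mean (l : R) A B : H -> H :=
  op_powR A 2^-1 \o
  op_powR (op_powR A (- 2^-1) \o B \o op_powR A (- 2^-1)) l \o
  op_powR A 2^-1.

(* [S] is the adjoint of [A] (there is at most one). *)
Definition is_adjoint (dot : {dot H for Num.conj}) A S :=
  forall x y, dot (A x) y = dot x (S y).

Definition selfadjoint (dot : {dot H for Num.conj}) A :=
  bounded_operator A /\ is_adjoint dot A A.

Definition positive_operator (dot : {dot H for Num.conj}) A :=
  selfadjoint dot A /\ forall x, 0 <= dot x (A x).

Definition op_le (dot : {dot H for Num.conj}) A B :=
  positive_operator dot (B - A).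

End Operators.

(* Main.v *)
(* Write [X = A^(-1/2) B A^(-1/2)].  The hypotheses give [1 <= X <= M / m], and
   [B], [A #_l B] and [(1 - l) A + l B] are the congruences by [A^(1/2)] of [X],
   [X^l] and [1 - l + l X].  So everything reduces to inequalities between
   functions of one real variable in [[1, M / m]], which follow from
   [1 + u <= exp u].

   The calculus rests on [|p(A)| <= sup |p|] over the spectrum of a self-adjoint
   [A]: if [c] is the least constant with [p(A)^* p(A) <= c], then
   [c - p(A)^* p(A)] is not invertible, and factoring the polynomial
   [c - p^* p] over the complex numbers gives a spectral point [z] with
   [|p(z)|^2 = c].  Weierstrass approximation is only needed for Lipschitz
   functions, where Bernstein polynomials give it directly. *)
Require Import Defs.
From mathcomp Require Import all_boot all_order all_algebra.
From mathcomp Require Import all_classical all_reals all_analysis.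
From mathcomp Require Import ring lra.
Set Implicit Arguments.
Unset Strict Implicit.
Unset Printing Implicit Defensive.
Import Order.TTheory GRing.Theory Num.Theory.
Import numFieldNormedType.Exports.
Local Open Scope classical_set_scope.
Local Open Scope ring_scope.
Local Open Scope complex_scope.

(** * Scalar inequalities and polynomial approximation of powers *)

(** The adjoint of a general bounded operator is never formed, which would take the Riesz theorem.
    Only polynomials in a self-adjoint [A] need one, and conjugating the coefficients provides it.
    Since the spectrum of [A] is real, the value of [p^* p] at a spectral point is then [|p|^2].
    Locating the spectrum requires a supply of invertible operators. Coercive operators serve,
    inverted by a fixed-point iteration: they make the spectrum real and turn bounds on the
    quadratic form of [A] into an interval containing it. The sup bound for polynomials passes to
    limits and gives the algebra, the uniqueness and the monotonicity of the calculus. Monotonicity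
    uses no square root of a function: [0 <= f <= J] says [|J - f| <= J], a statement about norms.
    The order is tested on real quadratic forms, where the congruence by [A^(1/2)] is the
    substitution of [A^(1/2) x] for [x]. The factor [x] of the second scalar bound becomes [X] and
    hence the factor [B] of the difference inequality. The zero space stands apart: spectra are
    empty there and the hypotheses do not force [m <= M]. *)

Section RealFunctions.
Context {R : realType}.
Implicit Types l x h : R.

(** Divided by [x^l], the claim is [1 <= (1 - l) x^(-l) + l x^(1 - l)]. Bound both powers below by
    [1 + u <= exp u]: in the weighted sum the terms linear in [ln x] cancel. *)
Lemma powR_le_affine l x : 0 <= l <= 1 -> 0 < x -> x `^ l <= 1 - l + l * x.
Proof.
move=> l01 x0; rewrite /powR gt_eqF//.
have {2}-> : x = expR (l * ln x) * expR ((1 - l) * ln x).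
  by rewrite -expRD -mulrDl addrC subrK mul1r lnK.
have h0 : 1 = expR (l * ln x) * expR (- (l * ln x)) by rewrite expRxMexpNx_1.
have h1 := expR_ge1Dx (- (l * ln x)).
have h2 := expR_ge1Dx ((1 - l) * ln x).
have y0 := expR_gt0 (l * ln x).
set y := expR _ in h0 y0 *; set u := expR _ in h0 h1; set v := expR _ in h2 *.
set t := ln x in h1 h2.
have : 0 <= y * ((1 - l) * (u - (1 + - (l * t))) + l * (v - (1 + (1 - l) * t))).
  apply: mulr_ge0; [lra|apply: addr_ge0; apply: mulr_ge0; lra].
nra.
Qed.

(** Two uses of [ln z <= z - 1] bound the logarithm of the ratio by [l (1 - l) (x - 1)^2 / x]. The
    denominator is dropped because [1 <= x], and [x <= h] gives the constant. *)
Lemma affine_le_expR_powR l x h : 0 <= l <= 1 -> 1 <= x -> x <= h ->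
  1 - l + l * x <= expR (l * (1 - l) * (1 - h) ^+ 2) * x `^ l.
Proof.
move=> l01 x1 xh; have x0 : 0 < x by lra.
pose y := 1 - l + l * x; have y0 : 0 < y by rewrite /y; nra.
rewrite -/y /powR gt_eqF// -expRD -{1}(lnK (y0 : y \is Num.pos)) ler_expR.
have le_ln (z : R) : 0 < z -> ln z <= z - 1.
  by move=> z0; have := expR_ge1Dx (ln z); rewrite lnK// => ?; lra.
have := le_ln _ y0; have := le_ln (y / x) (divr_gt0 y0 x0).
rewrite ln_div ?posrE// => h1 h2.
(* [ln y - l ln x] is the convex combination of [ln (y / x)] and [ln y]. *)
have e1 : y / x - 1 = - ((1 - l) * (1 - x^-1)) by rewrite /y; field; lra.
rewrite {}e1 in h1.
have e2 : y - 1 = l * (x - 1) by rewrite /y; ring.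
rewrite {}e2 in h2.
have xV : x^-1 * x = 1 by rewrite mulVf// gt_eqF.
have xV0 : 0 < x^-1 by rewrite invr_gt0.
have : l * (ln y - ln x) + (1 - l) * ln y <= l * (1 - l) * (x - 1 - (1 - x^-1)).
  have : 0 <= l * (- ((1 - l) * (1 - x^-1)) - (ln y - ln x)) by apply: mulr_ge0; lra.
  have : 0 <= (1 - l) * (l * (x - 1) - ln y) by apply: mulr_ge0; lra.
  nra.
have : l * (1 - l) * (x - 1 - (1 - x^-1)) <= l * (1 - l) * (1 - h) ^+ 2.
  apply: ler_wpM2l; first by apply: mulr_ge0; lra.
  have -> : x - 1 - (1 - x^-1) = (x - 1) ^+ 2 * x^-1 by field; lra.
  apply: (@le_trans _ _ ((x - 1) ^+ 2)); last nra.
  by rewrite ler_piMr ?sqr_ge0// invf_le1.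
lra.
Qed.

(** With [t = ln x], the gap is [l (x - x^l) + (1 - l) (1 - x^l)], at most [l (1 - l) t (x - 1)] by
    two tangent bounds. Then [x - 1 <= t x] supplies the second logarithm. *)
Lemma affine_le_powR_add l x h : 0 <= l <= 1 -> 1 <= x -> x <= h ->
  1 - l + l * x <= x `^ l + l * (1 - l) * ln h ^+ 2 * x.
Proof.
move=> l01 x1 xh; have x0 : 0 < x by lra.
rewrite /powR gt_eqF//.
have t0 : 0 <= ln x by exact: ln_ge0.
have th : ln x <= ln h by rewrite ler_ln ?posrE//; lra.
have h1 := expR_ge1Dx (l * ln x).
have h2 : x - expR (l * ln x) <= (1 - l) * ln x * x.
  have -> : expR (l * ln x) = x * expR (- ((1 - l) * ln x)).
    by rewrite -{2}(lnK (x0 : x \is Num.pos)) -expRD; congr expR; ring.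
  have := expR_ge1Dx (- ((1 - l) * ln x)); nra.
have h3 : x - 1 <= ln x * x.
  have : expR (- ln x) * x = 1.
    by rewrite -{2}(lnK (x0 : x \is Num.pos)) -expRD addNr expR0.
  have := expR_ge1Dx (- ln x); nra.
have h4 : ln x ^+ 2 <= ln h ^+ 2 by rewrite ler_sqr ?nnegrE//; lra.
set y := expR _ in h1 h2 *; set t := ln x in t0 th h1 h2 h3 h4.
set s := ln h in th h4 *.
have ll : 0 <= l * (1 - l) by apply: mulr_ge0; lra.
have e1 : 0 <= l * (1 - l) * x * (s ^+ 2 - t ^+ 2).
  by apply: mulr_ge0; [apply: mulr_ge0; lra|lra].
have e2 : 0 <= l * (1 - l) * t * (t * x - (x - 1)).
  by apply: mulr_ge0; [apply: mulr_ge0; lra|lra].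
have e3 : 0 <= l * ((1 - l) * t * x - (x - y)) by apply: mulr_ge0; lra.
have e4 : 0 <= (1 - l) * (y - (1 + l * t)) by apply: mulr_ge0; lra.
nra.
Qed.

(** The tangent bound for [exp] gives [x^a - y^a <= a x^a (ln x - ln y)], and [ln] has Lipschitz
    constant [1 / m] above [m]. *)
Lemma powR_lipschitz (a m K : R) : 0 < m -> exists L : R, 0 <= L /\
  forall x y : R, m <= x <= K -> m <= y <= K -> `|x `^ a - y `^ a| <= L * `|x - y|.
Proof.
(* The maximum of the power is at [K] or at [m] according to the sign of [a]; the sum covers both
   cases. *)
move=> m0; pose C := m `^ a + K `^ a.
have C0 : 0 <= C by rewrite addr_ge0 ?powR_ge0.
have powC x : m <= x <= K -> x `^ a <= C.
  move=> /andP[mx xK]; have x0 : 0 < x by lra.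
  have [a0|a0] := leP 0 a.
    have : x `^ a <= K `^ a by rewrite ge0_ler_powR// nnegrE; lra.
    by move=> /le_trans; apply; rewrite lerDr powR_ge0.
  have : x `^ a <= m `^ a.
    rewrite /powR !gt_eqF// ler_expR ler_wnM2l//; first lra.
    by rewrite ler_ln ?posrE.
  by move=> /le_trans; apply; rewrite lerDl powR_ge0.
exists (C * `|a| / m); split; first by rewrite !mulr_ge0// invr_ge0 ltW.
suff half x y : m <= x <= K -> m <= y <= K -> x `^ a - y `^ a <= C * `|a| / m * `|x - y|.
  move=> x y hx hy; rewrite ler_norml half// andbT lerNl opprB distrC.
  exact: half.
move=> hx hy; have x0 : 0 < x by lra. have y0 : 0 < y by lra.
have ln1 (u v : R) : m <= u -> m <= v -> ln u - ln v <= `|u - v| / m.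
  move=> hu hv; have u0 : 0 < u by lra. have v0 : 0 < v by lra.
  rewrite -ln_div ?posrE//; have := expR_ge1Dx (ln (u / v)).
  rewrite lnK ?posrE ?divr_gt0// => huv.
  apply: (@le_trans _ _ ((u - v) / v)).
    by rewrite mulrBl divff ?gt_eqF//; lra.
  apply: (@le_trans _ _ (`|u - v| / v)).
    by rewrite ler_wpM2r ?invr_ge0 ?(ltW v0)// ler_norm.
  by rewrite ler_wpM2l// lef_pV2 ?posrE.
have dln : `|ln x - ln y| <= `|x - y| / m.
  rewrite ler_norml lerNl opprB ln1 ?andbT; [|lra|lra].
  by rewrite distrC ln1//; lra.
have hxE : x `^ a = expR (a * ln x) by rewrite /powR gt_eqF.
have hyE : y `^ a = x `^ a * expR (a * (ln y - ln x)).
  by rewrite hxE /powR gt_eqF// -expRD; congr expR; ring.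
have E1 := expR_ge1Dx (a * (ln y - ln x)).
apply: (@le_trans _ _ (x `^ a * (a * (ln x - ln y)))).
  have := powR_ge0 x a; rewrite hyE; nra.
apply: (@le_trans _ _ (x `^ a * (`|a| * `|ln x - ln y|))).
  by rewrite ler_wpM2l ?powR_ge0// -normrM ler_norm.
rewrite -!mulrA; apply: ler_pM; rewrite ?powR_ge0 ?powC// ?mulr_ge0//.
by rewrite ler_wpM2l// mulrC.
Qed.

(* The Bernstein polynomial [\sum_k F k * 'C(n, k) * X ^ k * (1 - X) ^ (n - k)],
   defined through Pascal's rule. *)
Fixpoint bernstein (n : nat) (F : nat -> R) : {poly R} :=
  if n is n'.+1 then
    'X * bernstein n' (fun k => F k.+1) + (1 - 'X) * bernstein n' F
  else (F 0%N)%:P.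

Lemma bernsteinS n F x : (bernstein n.+1 F).[x] =
  x * (bernstein n (fun k => F k.+1)).[x] + (1 - x) * (bernstein n F).[x].
Proof. by rewrite /= !hornerE. Qed.

Lemma bernstein_le n F G x : 0 <= x <= 1 -> (forall k, (k <= n)%N -> F k <= G k) ->
  (bernstein n F).[x] <= (bernstein n G).[x].
Proof.
move=> x01; elim: n F G => [|n IH] F G FG; first by rewrite /= !hornerC FG.
rewrite !bernsteinS; apply: lerD; apply: ler_wpM2l; try lra; apply: IH => k kn.
- exact: FG.
- by apply: FG; rewrite leqW.
Qed.

Lemma bernstein_sqr n (a b c x : R) :
  (bernstein n (fun k => a + b * (k%:R - c) ^+ 2)).[x] =
  a + b * (n%:R * x * (1 - x) + (n%:R * x - c) ^+ 2).
Proof.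
elim: n c => [|n IH] c; first by rewrite /= hornerC; ring.
rewrite bernsteinS IH.
have -> : (fun k => a + b * (k.+1%:R - c) ^+ 2) = (fun k => a + b * (k%:R - (c - 1)) ^+ 2).
  by apply/funext => k; rewrite -natr1; ring.
by rewrite IH -natr1; ring.
Qed.

Lemma bernstein_approx (g : R -> R) (L e : R) : 0 <= L -> 0 < e ->
  (forall x y : R, 0 <= x <= 1 -> 0 <= y <= 1 -> `|g x - g y| <= L * `|x - y|) ->
  exists p : {poly R}, forall x, 0 <= x <= 1 -> `|p.[x] - g x| <= e.
Proof.
move=> L0 e0 gL; pose d := e / (L + 1).
have d0 : 0 < d by rewrite divr_gt0//; lra.
have Ld : L * d <= e.
  have : d * (L + 1) = e by rewrite /d mulfVK// gt_eqF//; lra.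
  nra.
pose n := (Num.truncn ((d ^+ 2)^-1)).+1.
have n0 : 0 < n%:R :> R by rewrite ltr0n.
have nd : n%:R^-1 <= d ^+ 2.
  rewrite -[leRHS]invrK lef_pV2 ?posrE ?invr_gt0 ?exprn_gt0//.
  by rewrite ltW// /n truncnS_gt// invr_ge0 exprn_ge0// ltW.
have nV : n%:R^-1 * n%:R = 1 :> R by rewrite mulVf// gt_eqF.
have nV0 : 0 < n%:R^-1 :> R by rewrite invr_gt0.
exists (bernstein n (fun k => g (k%:R / n%:R))) => x x01.
(* The bound [|u| <= d / 2 + u^2 / (2 d)] for [u = k / n - x] replaces the distance by a square, so
   the second moment suffices. With [1 / n <= d^2] the two resulting errors are each at most
   [L d / 2]. *)
pose q k : R := L / (2 * d * n%:R ^+ 2) * (k%:R - n%:R * x) ^+ 2.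
have gq k : (k <= n)%N -> `|g (k%:R / n%:R) - g x| <= L * d / 2 + q k.
  move=> kn; have k01 : 0 <= (k%:R / n%:R : R) <= 1.
    apply/andP; split; first exact: divr_ge0.
    by rewrite (ler_pdivrMr _ _ n0) mul1r ler_nat.
  apply: (le_trans (gL _ _ k01 x01)).
  have -> : q k = L * ((k%:R / n%:R - x) ^+ 2 / (2 * d)).
    by rewrite /q; field; rewrite !gt_eqF.
  rewrite -[L * d / 2]mulrA -mulrDr ler_wpM2l// -real_normK ?num_real//.
  have -> : d / 2 + `|k%:R / n%:R - x| ^+ 2 / (2 * d) =
      (d ^+ 2 + `|k%:R / n%:R - x| ^+ 2) / (2 * d) by field; rewrite gt_eqF.
  have d2 : 0 < 2 * d by lra.
  rewrite (ler_pdivlMr _ _ d2).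
  have := sqr_ge0 (d - `|k%:R / n%:R - x|); nra.
have bd (c s : R) : (bernstein n (fun k => c + s * q k)).[x] =
    c + s * (L / (2 * d) * (x * (1 - x)) * n%:R^-1).
  have -> : (fun k => c + s * q k) = (fun k =>
      c + (s * (L / (2 * d * n%:R ^+ 2))) * (k%:R - n%:R * x) ^+ 2).
    by apply/funext => k; rewrite /q mulrA.
  rewrite bernstein_sqr subrr expr0n addr0; field; rewrite !gt_eqF//.
have small : L * d / 2 + L / (2 * d) * (x * (1 - x)) * n%:R^-1 <= e.
  apply: le_trans Ld.
  have eLd : L * d = L * d / 2 + L / (2 * d) * d ^+ 2 by field; rewrite gt_eqF.
  rewrite [leRHS]eLd lerD2l -[leLHS]mulrA ler_wpM2l//; first by rewrite divr_ge0//; lra.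
  apply: le_trans nd; rewrite -[leRHS]mul1r ler_wpM2r ?(ltW nV0)//; nra.
rewrite ler_norml; apply/andP; split.
  have : (bernstein n (fun k => g x - L * d / 2 + (- 1) * q k)).[x] <=
      (bernstein n (fun k => g (k%:R / n%:R))).[x].
    by apply: bernstein_le => // k /gq; rewrite ler_norml => /andP[? ?]; lra.
  rewrite bd; lra.
have : (bernstein n (fun k => g (k%:R / n%:R))).[x] <=
    (bernstein n (fun k => g x + L * d / 2 + 1 * q k)).[x].
  by apply: bernstein_le => // k /gq; rewrite ler_norml => /andP[? ?]; lra.
rewrite bd; lra.
Qed.

Lemma powR_poly_approx (a m K e : R) : 0 < m -> m <= K -> 0 < e ->
  exists p : {poly R}, forall x, m <= x <= K -> `|p.[x] - x `^ a| <= e.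
Proof.
move=> m0 mK e0; have [L [L0 powL]] := powR_lipschitz a K m0.
have [mEK|mNK] := eqVneq m K.
  exists (m `^ a)%:P => x /andP[h1 h2]; have -> : x = m by lra.
  by rewrite hornerC subrr normr0 ltW.
have D0 : 0 < K - m by rewrite subr_gt0 lt_neqAle mNK.
have [||p hp] := @bernstein_approx (fun t => (m + t * (K - m)) `^ a) (L * (K - m)) e _ e0.
- by rewrite mulr_ge0// ltW.
- have seg (t : R) : 0 <= t <= 1 -> m <= m + t * (K - m) <= K.
    by move=> t01; apply/andP; split; nra.
  move=> x y x01 y01; apply: (le_trans (powL _ _ (seg _ x01) (seg _ y01))).
  have -> : m + x * (K - m) - (m + y * (K - m)) = (x - y) * (K - m) by ring.
  by rewrite normrM (gtr0_norm D0) [`|_| * _]mulrC mulrA.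
exists (p \Po ((K - m)^-1 *: ('X - m%:P))) => x xmK.
have t01 : 0 <= (x - m) / (K - m) <= 1.
  by rewrite divr_ge0 ?ler_pdivrMr//= ?mul1r; lra.
have := hp _ t01; rewrite horner_comp !hornerE mulrC.
by rewrite [X in X `^ a](_ : _ = x)//; field; lra.
Qed.

End RealFunctions.

(** * Bounded operators *)

Section RealNorm.
Context {R : realType}.

(** The library norm has values in [R[i]], which is only partially ordered; in [R] the tactics [lra]
    and [nra] apply. *)
Definition nrm {V : normedZmodType R[i]} (x : V) : R := complex.Re `|x|.

Section Basic.
Context {V : normedZmodType R[i]}.
Implicit Types x y : V.

Lemma nrmE x : `|x| = (nrm x)%:C.
Proof. by rewrite /nrm RRe_real//; exact: ger0_real (normr_ge0 x). Qed.

Lemma nrm_ge0 x : 0 <= nrm x.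
Proof. by have := normr_ge0 x; rewrite nrmE ler0c. Qed.

Lemma nrm0 : nrm (0 : V) = 0.
Proof. by rewrite /nrm normr0. Qed.

Lemma nrm_eq0 x : nrm x = 0 -> x = 0.
Proof. by move=> x0; apply/eqP; rewrite -normr_eq0 nrmE x0. Qed.

Lemma nrmN x : nrm (- x) = nrm x.
Proof. by rewrite /nrm normrN. Qed.

Lemma nrmB x y : nrm (x - y) = nrm (y - x).
Proof. by rewrite /nrm distrC. Qed.

Lemma ler_nrmD x y : nrm (x + y) <= nrm x + nrm y.
Proof. by have := ler_normD x y; rewrite !nrmE -rmorphD/= lecR. Qed.

Lemma ler_nrm_dist z x y : nrm (x - y) <= nrm (x - z) + nrm (z - y).
Proof. by rewrite -{1}[x](subrK z) -addrA ler_nrmD. Qed.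

End Basic.

Lemma nrmM (a b : R[i]) : nrm (a * b) = nrm a * nrm b.
Proof. by apply: (@complexI R); rewrite rmorphM/= -!nrmE normrM. Qed.

Lemma nrmC (a : R) : nrm (a%:C : R[i]) = `|a|.
Proof. by rewrite /nrm normc_def /= expr0n addr0 sqrtr_sqr. Qed.

Lemma nrmZ {V : normedModType R[i]} (a : R[i]) (x : V) : nrm (a *: x) = nrm a * nrm x.
Proof. by apply: (@complexI R); rewrite rmorphM/= -!nrmE normrZ. Qed.

(** The limit inherits the given rate [e]. This serves both the fixed-point iteration and the limits
    that define the functional calculus. *)
Lemma cauchy_seq_cvg {H : completeNormedModType R[i]} (u : nat -> H) (e : nat -> R) :
  (forall n m, (n <= m)%N -> nrm (u m - u n) <= e n) ->
  (forall d : R, 0 < d -> exists n, e n <= d) ->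
  exists v, forall n, nrm (v - u n) <= e n.
Proof.
move=> ue e0.
have /cauchy_cvgP/cvg_ex[v uv] : cauchy (u @ \oo).
  apply/cauchy_exP => -[d d']; rewrite ltcE/= => /andP[/eqP -> d0].
  have [n en] := e0 _ (divr_gt0 d0 (ltr0Sn _ 1)).
  exists (u n); exists n => // m /= nm; rewrite -ball_normE /= nrmE nrmB.
  by rewrite ltcR; have := ue _ _ nm; lra.
exists v => n; apply/ler_addgt0Pr => d d0.
move/cvgrPdist_lt : uv => /(_ d%:C); rewrite ltcR => /(_ d0)[N _ uv].
have := uv _ (leq_maxr n N); have := ue _ _ (leq_maxl n N).
rewrite nrmE ltcR; have := ler_nrm_dist (u (maxn n N)) v (u n); lra.
Qed.

End RealNorm.

Section BoundedOperators.
Context {R : realType} {H : completeNormedModType R[i]}.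
Implicit Types (A B S T : H -> H) (x y : H) (a b : R[i]).

Lemma bounded_operatorP A : bounded_operator A <->
  linear A /\ exists k : R, 0 < k /\ forall x, nrm (A x) <= k * nrm x.
Proof.
split=> -[linA [k hk]]; split=> //.
  exists (`|k| + 1); split=> [|x]; first by rewrite ltr_wpDl.
  have := hk x; rewrite !nrmE -rmorphM lecR => /le_trans; apply.
  by rewrite ler_wpM2r ?nrm_ge0//; have := ler_norm k; lra.
by exists k => x; rewrite !nrmE -rmorphM lecR; case: hk.
Qed.

Section Linear.
Context {A : H -> H} (A_bounded : bounded_operator A).

Lemma boundedD x y : A (x + y) = A x + A y.
Proof. by have := A_bounded.1 1 x y; rewrite !scale1r. Qed.

Lemma bounded0 : A 0 = 0.
Proof. by apply: (@addIr _ (A 0)); rewrite -boundedD !add0r. Qed.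

Lemma boundedZ a x : A (a *: x) = a *: A x.
Proof. by have := A_bounded.1 a x 0; rewrite bounded0 !addr0. Qed.

Lemma boundedN x : A (- x) = - A x.
Proof. by rewrite -scaleN1r boundedZ scaleN1r. Qed.

Lemma boundedB x y : A (x - y) = A x - A y.
Proof. by rewrite boundedD boundedN. Qed.

End Linear.

Lemma op_addE A B x : (A + B) x = A x + B x. Proof. by []. Qed.

Lemma op_oppE A x : (- A) x = - A x. Proof. by []. Qed.

Lemma op_scaleE a A x : (a *: A) x = a *: A x. Proof. by []. Qed.

Definition opE := (op_addE, op_oppE, op_scaleE).

Lemma bounded_id : bounded_operator (@idfun H).
Proof.
by apply/bounded_operatorP; split=> //; exists 1; split=> // x; rewrite mul1r.
Qed.

Lemma bounded_add A B : bounded_operator A -> bounded_operator B -> bounded_operator (A + B).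
Proof.
move=> hA hB; have [_ [k [k0 hk]]] := iffLR (bounded_operatorP _) hA.
have [_ [j [j0 hj]]] := iffLR (bounded_operatorP _) hB.
apply/bounded_operatorP; split.
  move=> a x y; rewrite !opE (boundedD hA) (boundedD hB) (boundedZ hA) (boundedZ hB).
  by rewrite scalerDr addrACA.
exists (k + j); split; first by rewrite addr_gt0.
by move=> x; rewrite mulrDl (le_trans (ler_nrmD _ _))// lerD.
Qed.

Lemma bounded_scale a A : bounded_operator A -> bounded_operator (a *: A).
Proof.
move=> hA; have [_ [k [k0 hk]]] := iffLR (bounded_operatorP _) hA.
apply/bounded_operatorP; split.
  move=> b x y; rewrite !opE (boundedD hA) (boundedZ hA).
  by rewrite scalerDr !scalerA mulrC.
exists ((nrm a + 1) * k); split; first by rewrite mulr_gt0// ltr_wpDl// nrm_ge0.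
move=> x; rewrite nrmZ -mulrA; apply: ler_pM => //; rewrite ?nrm_ge0//; lra.
Qed.

Lemma bounded_opp A : bounded_operator A -> bounded_operator (- A).
Proof. by move=> /(bounded_scale (-1)); rewrite scaleN1r. Qed.

Lemma bounded_sub A B : bounded_operator A -> bounded_operator B -> bounded_operator (A - B).
Proof. by move=> hA hB; apply: bounded_add => //; exact: bounded_opp. Qed.

Lemma bounded_comp A B : bounded_operator A -> bounded_operator B -> bounded_operator (A \o B).
Proof.
move=> hA hB; have [_ [k [k0 hk]]] := iffLR (bounded_operatorP _) hA.
have [_ [j [j0 hj]]] := iffLR (bounded_operatorP _) hB.
apply/bounded_operatorP; split.
  by move=> a x y /=; rewrite (boundedD hB) (boundedZ hB) (boundedD hA) (boundedZ hA).
exists (k * j); split=> [|x /=]; first exact: mulr_gt0.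
by rewrite (le_trans (hk _))// -mulrA ler_wpM2l// ltW.
Qed.

Lemma invertible_comp A B : invertible A -> invertible B -> invertible (A \o B).
Proof.
move=> [S [hS AS SA]] [T [hT BT TB]]; exists (T \o S); split.
- exact: bounded_comp.
- apply/funext => x /=; rewrite -[RHS](congr1 (@^~ x) AS) /=; congr A.
  exact: (congr1 (@^~ (S x)) BT).
- apply/funext => x /=; rewrite -[RHS](congr1 (@^~ x) TB) /=; congr T.
  exact: (congr1 (@^~ (B x)) SA).
Qed.

Lemma invertible_scale a A : bounded_operator A -> invertible (a *: A) -> invertible A.
Proof.
move=> hA [S [hS AS SA]]; exists (a *: S); split; first exact: bounded_scale.
- apply/funext => x /=; have := congr1 (@^~ x) AS; rewrite /= => {2}<-.
  by rewrite !opE (boundedZ hA).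
- apply/funext => x /=; have := congr1 (@^~ x) SA; rewrite /= => {2}<-.
  by rewrite !opE (boundedZ hS).
Qed.

End BoundedOperators.

Section Polynomials.
Context {R : realType} {H : completeNormedModType R[i]}.
Implicit Types (A B S T : H -> H) (x y : H) (p q : {poly R[i]}).

Lemma poly_opE n p A x : (size p <= n)%N ->
  poly_op p A x = \sum_(k < n) p`_k *: iter k A x.
Proof.
move=> pn; rewrite /poly_op (big_ord_widen n (fun k => p`_k *: iter k A x) pn).
rewrite big_mkcond; apply: eq_bigr => k _; case: ltnP => // pk.
by rewrite nth_default ?scale0r.
Qed.

Lemma poly_opD p q A : poly_op (p + q) A = poly_op p A + poly_op q A.
Proof.
apply/funext => x; rewrite opE; pose n := maxn (size p) (size q).
rewrite (@poly_opE n (p + q)) ?size_polyD// (@poly_opE n p) ?leq_maxl//.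
rewrite (@poly_opE n q) ?leq_maxr// -big_split; apply: eq_bigr => k _ /=.
by rewrite coefD scalerDl.
Qed.

Lemma poly_opZ a p A : poly_op (a *: p) A = a *: poly_op p A.
Proof.
apply/funext => x; rewrite opE (@poly_opE (size p)) ?size_scale_leq//.
by rewrite /poly_op scaler_sumr; apply: eq_bigr => k _; rewrite coefZ scalerA.
Qed.

Lemma poly_opC a A : poly_op a%:P A = a *: idfun.
Proof.
apply/funext => x; rewrite (@poly_opE 1) ?size_polyC_leq1//.
by rewrite big_ord1 coefC.
Qed.

Lemma poly_opN p A : poly_op (- p) A = - poly_op p A.
Proof. by rewrite -scaleN1r poly_opZ scaleN1r. Qed.

Lemma poly_opB p q A : poly_op (p - q) A = poly_op p A - poly_op q A.
Proof. by rewrite poly_opD poly_opN. Qed.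

Lemma poly_opMX p A : poly_op (p * 'X) A = poly_op p A \o A.
Proof.
apply/funext => x; rewrite (@poly_opE (size p).+1); last first.
  by have [->|p0] := eqVneq p 0; rewrite ?mul0r ?size_poly0// size_mulX.
rewrite big_ord_recl coefMX /= scale0r add0r /poly_op; apply: eq_bigr => k _.
by rewrite coefMX /= -iterSr.
Qed.

Lemma poly_opX A : poly_op 'X A = A.
Proof. by rewrite -['X]mul1r poly_opMX poly_opC scale1r. Qed.

Section Bounded.
Context {A : H -> H} (A_bounded : bounded_operator A).

Lemma bounded_poly_op p : bounded_operator (poly_op p A).
Proof.
elim/poly_ind: p => [|p c IH].
  by rewrite poly_opC; apply: bounded_scale; exact: bounded_id.
rewrite poly_opD poly_opMX poly_opC; apply: bounded_add.
  exact: bounded_comp.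
by apply: bounded_scale; exact: bounded_id.
Qed.

Lemma poly_op_comm p x : poly_op p A (A x) = A (poly_op p A x).
Proof.
elim/poly_ind: p x => [|p c IH] x.
  by rewrite poly_opC !opE !scale0r bounded0.
by rewrite poly_opD poly_opMX poly_opC !opE /= IH (boundedD A_bounded) (boundedZ A_bounded).
Qed.

Lemma poly_opM p q : poly_op (p * q) A = poly_op p A \o poly_op q A.
Proof.
elim/poly_ind: p => [|p c IH].
  by rewrite mul0r poly_opC; apply/funext => x /=; rewrite !opE !scale0r.
rewrite mulrDl mul_polyC poly_opD poly_opZ mulrAC poly_opMX IH.
by apply/funext => x; rewrite poly_opD poly_opMX poly_opC /= !opE /= poly_op_comm.
Qed.

End Bounded.

(** If no root of [p] were spectral, every linear factor of [p(A)] would be invertible, and so would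
    their product. *)
Lemma not_invertible_root A p : bounded_operator A -> p != 0 ->
  ~ invertible (poly_op p A) -> exists2 z, spectrum A z & root p z.
Proof.
move=> hA p0 Np; have [rs pE] := closed_field_poly_normal p.
apply: contrapT => Nz; apply: Np; rewrite pE poly_opZ.
have l0 : lead_coef p != 0 by rewrite lead_coef_eq0.
have hi : invertible (poly_op (\prod_(z <- rs) ('X - z%:P)) A).
  have : {in rs, forall z, root p z}.
    by move=> z zrs; rewrite pE rootZ// root_prod_XsubC.
  elim: rs {pE} => [_|z rs IH zrs].
    rewrite big_nil poly_opC scale1r.
    by exists idfun; split=> //; exact: bounded_id.
  rewrite big_cons poly_opM//; apply: invertible_comp; last first.
    by apply: IH => w wrs; apply: zrs; rewrite inE wrs orbT.
  rewrite poly_opB poly_opX poly_opC; apply: contrapT => h.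
  by apply: Nz; exists z => //; apply: zrs; rewrite inE eqxx.
apply: (@invertible_scale _ _ (lead_coef p)^-1).
  by apply: bounded_scale; exact: bounded_poly_op.
by rewrite scalerA mulVf// scale1r.
Qed.

End Polynomials.

(** * Real inner product and coercive operators *)

Lemma geometric_small {R : realType} (q C d : R) : 0 <= q < 1 -> 0 < d ->
  exists n, q ^+ n * C <= d.
Proof.
move=> /andP[q0 q1] d0.
have : (geometric C q @ \oo --> (0 : R))%classic by apply: cvg_geometric; rewrite ger0_norm.
move=> /cvgrPdist_le/(_ _ d0)[n _ /(_ n (leqnn n))]; rewrite /= sub0r normrN.
by exists n; rewrite mulrC (le_trans (ler_norm _)).
Qed.

Section Hilbert.
Context {R : realType} {H : completeNormedModType R[i]} (dot : {dot H for Num.conj}).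
Hypothesis dot_norm : forall x : H, dot x x = `|x| ^+ 2.
Implicit Types (A B S T : H -> H) (x y z : H).

(* Adjointness and positivity of complex linear maps can be tested on the real
   part of the inner product. *)
Definition rdot x y : R := complex.Re (dot x y).

Lemma rdotDl x y z : rdot (x + y) z = rdot x z + rdot y z.
Proof. by rewrite /rdot linearDl raddfD. Qed.

Lemma rdotDr x y z : rdot x (y + z) = rdot x y + rdot x z.
Proof. by rewrite /rdot linearDr raddfD. Qed.

Lemma dotC x y : dot x y = (dot y x)^*.
Proof. by rewrite (hermC dot) /= expr0 mul1r. Qed.

Lemma rdotC x y : rdot x y = rdot y x.
Proof. by rewrite /rdot dotC; case: (dot y x). Qed.

Lemma rdotNl x y : rdot (- x) y = - rdot x y.
Proof. by rewrite /rdot linearNl raddfN. Qed.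

Lemma rdotNr x y : rdot x (- y) = - rdot x y.
Proof. by rewrite rdotC rdotNl rdotC. Qed.

Lemma rdotBl x y z : rdot (x - y) z = rdot x z - rdot y z.
Proof. by rewrite rdotDl rdotNl. Qed.

Lemma rdotBr x y z : rdot x (y - z) = rdot x y - rdot x z.
Proof. by rewrite rdotDr rdotNr. Qed.

Lemma rdotZl (a : R) x y : rdot (a%:C *: x) y = a * rdot x y.
Proof.
by rewrite /rdot linearZl_LR /=; case: (dot x y) => u v /=; rewrite mul0r subr0.
Qed.

Lemma rdotZr (a : R) x y : rdot x (a%:C *: y) = a * rdot x y.
Proof. by rewrite rdotC rdotZl rdotC. Qed.

Lemma rdotxx x : rdot x x = nrm x ^+ 2.
Proof. by rewrite /rdot dot_norm nrmE -rmorphXn. Qed.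

Lemma rdot_il x y : rdot ('i *: x) y = - complex.Im (dot x y).
Proof.
by rewrite /rdot linearZl_LR /=; case: (dot x y) => u v /=; rewrite mul0r mul1r add0r.
Qed.

Lemma rdot_ir x y : rdot x ('i *: y) = complex.Im (dot x y).
Proof. by rewrite rdotC rdot_il dotC; case: (dot x y) => u v /=; rewrite opprK. Qed.

Lemma nrmB_sqr x y : nrm (x - y) ^+ 2 = nrm x ^+ 2 - 2 * rdot x y + nrm y ^+ 2.
Proof. by rewrite -!rdotxx rdotBl !rdotBr (rdotC y x); ring. Qed.

(** Cauchy-Schwarz, from expanding the squared norm of [|y| x - |x| y]. *)
Lemma rdot_le x y : rdot x y <= nrm x * nrm y.
Proof.
have [x0|x0] := eqVneq (nrm x) 0.
  by rewrite (nrm_eq0 x0) nrm0 mul0r /rdot linear0l.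
have [y0|y0] := eqVneq (nrm y) 0.
  by rewrite (nrm_eq0 y0) nrm0 mulr0 rdotC /rdot linear0l.
have xy0 : 0 < nrm x * nrm y.
  by rewrite mulr_gt0// lt0r ?x0 ?y0 nrm_ge0.
have := nrmB_sqr ((nrm y)%:C *: x) ((nrm x)%:C *: y).
rewrite rdotZl rdotZr !nrmZ !nrmC !(ger0_norm (nrm_ge0 _)).
have := sqr_ge0 (nrm ((nrm y)%:C *: x - (nrm x)%:C *: y)).
move=> h e; rewrite {}e in h.
have : 0 <= (nrm x * nrm y) * (nrm x * nrm y - rdot x y) by nra.
by rewrite pmulr_rge0// subr_ge0.
Qed.

Lemma coercive_invertible (c : R) A : bounded_operator A -> 0 < c ->
  (forall x, c * nrm x ^+ 2 <= rdot x (A x)) -> invertible A.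
Proof.
move=> hA c0 cA; have [_ [K [K0 hK]]] := iffLR (bounded_operatorP _) hA.
have lower x : c * nrm x <= nrm (A x).
  have [x0|x0] := eqVneq (nrm x) 0; first by rewrite x0 mulr0 nrm_ge0.
  have {}x0 : 0 < nrm x by rewrite lt0r x0 nrm_ge0.
  rewrite -(ler_pM2l x0); have := rdot_le x (A x); have := cA x; nra.
(* [x - t (A x - y)] is a contraction with fixed point [A^-1 y]. *)
pose J := K + c; have J0 : 0 < J by exact: addr_gt0.
(* This [t] minimises [1 - 2 t c + t^2 J^2], whose minimum is [q^2]. Adding [c] to [K] in [J]
   ensures [c <= J] without comparing [c] and [K]. *)
pose t := c / J ^+ 2; have t0 : 0 < t by rewrite divr_gt0// exprn_gt0.
pose q : R := Num.sqrt (1 - c ^+ 2 / J ^+ 2).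
have q2 : q ^+ 2 = 1 - c ^+ 2 / J ^+ 2.
  rewrite sqr_sqrtr// subr_ge0 ler_pdivrMr ?exprn_gt0// mul1r.
  by rewrite ler_sqr ?nnegrE /J; lra.
have q0 : 0 <= q by exact: sqrtr_ge0.
have q1 : q < 1.
  have : 0 < c ^+ 2 / J ^+ 2 by rewrite divr_gt0 ?exprn_gt0.
  nra.
have contr x : nrm (x - t%:C *: A x) <= q * nrm x.
  rewrite -ler_sqr ?nnegrE ?nrm_ge0//; last by rewrite mulr_ge0// nrm_ge0.
  rewrite nrmB_sqr rdotZr nrmZ nrmC ger0_norm ?(ltW t0)//
    [(q * _) ^+ 2]exprMn [(t * _) ^+ 2]exprMn q2.
  have h1 : nrm (A x) ^+ 2 <= J ^+ 2 * nrm x ^+ 2.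
    rewrite -exprMn ler_sqr ?nnegrE ?nrm_ge0//; last by rewrite mulr_ge0 ?nrm_ge0// ltW.
    by rewrite (le_trans (hK x))// ler_wpM2r ?nrm_ge0// /J; lra.
  have e1 : t ^+ 2 * (J ^+ 2 * nrm x ^+ 2) = t * c * nrm x ^+ 2.
    by rewrite /t; field; rewrite gt_eqF.
  have e2 : c ^+ 2 / J ^+ 2 = t * c by rewrite /t; field; rewrite gt_eqF.
  rewrite e2.
  have : t ^+ 2 * nrm (A x) ^+ 2 <= t ^+ 2 * (J ^+ 2 * nrm x ^+ 2).
    by rewrite ler_wpM2l// sqr_ge0.
  rewrite e1; have : t * (c * nrm x ^+ 2) <= t * rdot x (A x) by rewrite ler_pM2l.
  lra.
have surj y : exists x, A x = y.
  pose step x := x - t%:C *: A x + t%:C *: y.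
  have stepB x x' : nrm (step x - step x') <= q * nrm (x - x').
    apply: le_trans (contr _); rewrite (boundedB hA) le_eqVlt; apply/orP; left.
    apply/eqP; congr nrm; rewrite /step [- (_ + t%:C *: y)]opprD addrACA subrr addr0.
    by rewrite scalerBr [- (x' - _)]opprD addrACA -opprD.
  pose u n := iter n step 0.
  (* [C] solves [q C + d = C], so the iterates from 0 stay in the ball of radius [C]. Removing [n]
     common steps from [u m] and [u n] leaves [u (m - n)] and 0, whence the rate [q^n C]. *)
  pose d := nrm (t%:C *: y); pose C := d / (1 - q).
  have C0 : 0 <= C by rewrite divr_ge0 ?nrm_ge0// subr_ge0 ltW.
  have qC : q * C + d = C by rewrite /C; field; lra.
  have uC k : nrm (u k) <= C.
    elim: k => [|k IH]; first by rewrite /= nrm0.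
    rewrite /u iterS -/(u k) -[step _](subrK (step 0)) (le_trans (ler_nrmD _ _))//.
    rewrite -qC; apply: lerD.
      by apply: le_trans (stepB _ _) _; rewrite subr0 ler_wpM2l.
    by rewrite /step (bounded0 hA) scaler0 subrr add0r.
  have uq n m : (n <= m)%N -> nrm (u m - u n) <= q ^+ n * C.
    elim: n m => [|n IH] [|m]//; rewrite ?expr0 ?mul1r ?subr0//.
    by move=> nm; apply: le_trans (stepB _ _) _; rewrite exprS -mulrA ler_wpM2l ?IH.
  have q01 : 0 <= q < 1 by rewrite q0.
  have [v vu] := cauchy_seq_cvg uq (fun d d0 => geometric_small C q01 d0).
  exists v; apply/eqP; rewrite -subr_eq0; apply/eqP.
  have : v - step v = 0.
    apply: nrm_eq0; apply/eqP; rewrite eq_le nrm_ge0 andbT; apply/ler_addgt0Pr => e e0.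
    rewrite add0r; have [n hn] := geometric_small C q01 (divr_gt0 e0 (ltr0Sn _ 1)).
    have h1 := vu n.+1; have h2 := stepB (u n) v; have h3 := vu n.
    have := ler_nrm_dist (u n.+1) v (step v); rewrite {2}/u iterS -/(u n).
    rewrite nrmB in h3.
    have : q ^+ n.+1 * C <= q ^+ n * C.
      rewrite exprS -mulrA; apply: ler_piMl; last exact: ltW.
      exact: mulr_ge0 (exprn_ge0 n q0) C0.
    have : q * nrm (u n - v) <= nrm (u n - v).
      by apply: ler_piMl; [exact: nrm_ge0|exact: ltW].
    lra.
  rewrite /step opprD opprB addrA addrCA subrr addr0 -scalerBr => h.
  have /(congr1 ( *:%R (t%:C)^-1)) := h.
  rewrite scaler0 scalerA mulVf ?scale1r//.
  by apply/eqP => /complexI t00; rewrite t00 ltxx in t0.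
have inj x x' : A x = A x' -> x = x'.
  move=> xx'; apply/eqP; rewrite -subr_eq0; apply/eqP/nrm_eq0/eqP.
  have := lower (x - x'); rewrite (boundedB hA) xx' subrr nrm0 pmulr_rle0// => h.
  by rewrite eq_le h nrm_ge0.
have [S AS] := choice surj.
exists S; split; last 2 first.
- exact/funext.
- by apply/funext => x; apply: inj; rewrite AS.
apply/bounded_operatorP; split.
  by move=> a x y; apply: inj; rewrite (boundedD hA) (boundedZ hA) !AS.
exists c^-1; split=> [|x]; first by rewrite invr_gt0.
by rewrite ler_pdivlMl// (le_trans (lower _))// AS.
Qed.

Lemma selfadjointP A : selfadjoint dot A <->
  bounded_operator A /\ forall x y, rdot (A x) y = rdot x (A y).
Proof.
split=> -[hA]; first by move=> sA; split=> // x y; rewrite /rdot sA.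
move=> sA; split=> // x y.
(* Complex linearity of [A] makes the second instance an equality of imaginary parts. *)
have := sA x y; have := sA x ('i *: y).
rewrite (boundedZ hA) !rdot_ir /rdot.
by case: (dot (A x) y) (dot x (A y)) => u v [u' v'] /= -> ->.
Qed.

Lemma positive_operatorP A : positive_operator dot A <->
  selfadjoint dot A /\ forall x, 0 <= rdot x (A x).
Proof.
split=> -[sA pA]; split=> // x.
  by have := pA x; rewrite lecE /rdot => /andP[].
have /selfadjointP[hA rsA] := sA.
have := pA x; rewrite lecE /rdot => -> /=; rewrite andbT.
have := sA.2 x x; rewrite dotC; case: (dot x (A x)) => u v /= [] h.
by apply/eqP; lra.
Qed.

Lemma selfadjoint_id : selfadjoint dot (@idfun H).
Proof. by split=> //; exact: bounded_id. Qed.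

Lemma selfadjoint_scale (a : R) A : selfadjoint dot A -> selfadjoint dot (a%:C *: A).
Proof.
move=> /selfadjointP[hA sA]; apply/selfadjointP; split; first exact: bounded_scale.
by move=> x y; rewrite !opE rdotZl rdotZr sA.
Qed.

Lemma selfadjoint_add A B :
  selfadjoint dot A -> selfadjoint dot B -> selfadjoint dot (A + B).
Proof.
move=> /selfadjointP[hA sA] /selfadjointP[hB sB]; apply/selfadjointP.
by split=> [|x y]; [exact: bounded_add|rewrite !opE rdotDl rdotDr sA sB].
Qed.

Lemma selfadjoint_sub A B :
  selfadjoint dot A -> selfadjoint dot B -> selfadjoint dot (A - B).
Proof.
move=> /selfadjointP[hA sA] /selfadjointP[hB sB]; apply/selfadjointP.
by split=> [|x y]; [exact: bounded_sub|rewrite !opE rdotBl rdotBr sA sB].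
Qed.

Lemma selfadjoint_conj T A :
  selfadjoint dot T -> selfadjoint dot A -> selfadjoint dot (T \o A \o T).
Proof.
move=> /selfadjointP[hT sT] /selfadjointP[hA sA]; apply/selfadjointP.
by split=> [|x y /=]; [|by rewrite sT sA sT]; apply: bounded_comp => //; exact: bounded_comp.
Qed.

Lemma op_leP A B : selfadjoint dot A -> selfadjoint dot B ->
  op_le dot A B <-> forall x, rdot x (A x) <= rdot x (B x).
Proof.
move=> sA sB; split=> [/positive_operatorP[_ h] x|h].
  by have := h x; rewrite !opE rdotBr subr_ge0.
apply/positive_operatorP; split=> [|x]; first exact: selfadjoint_sub.
by rewrite !opE rdotBr subr_ge0.
Qed.

(** For any other [z = a + i b], a multiple of [A - z] is coercive, hence invertible. The factor is
    ['i] times the sign of [b] if [b] is nonzero, 1 if [a < m], and -1 if [K < a]. *)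
Lemma spectrum_itv (m K : R) A (z : R[i]) : selfadjoint dot A ->
  (forall x, m * nrm x ^+ 2 <= rdot x (A x)) ->
  (forall x, rdot x (A x) <= K * nrm x ^+ 2) ->
  spectrum A z -> exists2 t : R, z = t%:C & m <= t <= K.
Proof.
move=> /selfadjointP[hA sA] mA AK; case: z => a b.
pose T := A - (a +i* b) *: idfun => spz.
have hT : bounded_operator T.
  by apply: bounded_sub => //; apply: bounded_scale; exact: bounded_id.
have scaled_coercive (w : R[i]) (c : R) : 0 < c ->
    (forall x, c * nrm x ^+ 2 <= rdot x (w *: T x)) -> False.
  move=> c0 h; apply: spz; apply: (@invertible_scale _ _ w) => //.
  by apply: (coercive_invertible _ c0) => //; exact: bounded_scale.
have dotAx x : complex.Im (dot x (A x)) = 0.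
  have := sA ('i *: x) x; rewrite (boundedZ hA) rdot_il rdot_il dotC.
  by case: (dot x (A x)) => u v /=; lra.
have dotT x : dot x (T x) = (rdot x (A x) - a * nrm x ^+ 2) +i* (b * nrm x ^+ 2).
  rewrite /T !opE linearBr linearZ_LR /= dot_norm nrmE -rmorphXn /=.
  have := dotAx x; rewrite /rdot; case: (dot x (A x)) => u v /= ->.
  by apply/eqP; rewrite eq_complex /=; apply/andP; split; apply/eqP; ring.
have b0 : b = 0.
  apply: contrapT => /eqP b0.
  apply: (scaled_coercive ((Num.sg b)%:C * 'i) `|b|); first by rewrite normr_gt0.
  move=> x; rewrite -scalerA rdotZr rdot_ir dotT /=.
  by rewrite mulrA -normrEsg.
exists a; first by rewrite b0.
have rdotT x : rdot x (T x) = rdot x (A x) - a * nrm x ^+ 2 by rewrite /rdot dotT.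
rewrite !leNgt -negb_or; apply/negP => /orP[am|Ka].
  apply: (scaled_coercive 1 (m - a)); first lra.
  by move=> x; rewrite scale1r rdotT; have := mA x; lra.
apply: (scaled_coercive (-1)%:C (a - K)); first lra.
by move=> x; rewrite rdotZr rdotT; have := AK x; lra.
Qed.

End Hilbert.

(** * The norm of a polynomial in a self-adjoint operator *)

Section SpectralNorm.
Context {R : realType} {H : completeNormedModType R[i]} (dot : {dot H for Num.conj}).
Hypothesis dot_norm : forall x : H, dot x x = `|x| ^+ 2.
Implicit Types (A P Q S T : H -> H) (x y : H).
Local Notation dotR := (rdot dot).

Lemma dotZr (a : R[i]) x y : dot x (a *: y) = conjc a * dot x y.
Proof. by rewrite linearZ_LR. Qed.

Lemma dot_poly_op A p x y : selfadjoint dot A ->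
  dot (poly_op p A x) y = dot x (poly_op (map_poly conjc p) A y).
Proof.
move=> [hA sA]; elim/poly_ind: p x y => [|p c IH] x y.
  by rewrite rmorph0 poly_opC !opE !scale0r linear0l linear0r.
rewrite rmorphD rmorphM /= map_polyX map_polyC /= !poly_opD !poly_opMX !poly_opC !opE /=.
by rewrite linearDl linearDr /= IH sA linearZl_LR /= dotZr conjcK poly_op_comm.
Qed.

(* For the least [c] with [Q P <= c], the operator [c - Q P] is positive but
   not bounded below. *)
Lemma best_bound_not_invertible P Q x0 : x0 != 0 ->
  bounded_operator P -> bounded_operator Q ->
  (forall x y, dotR (P x) y = dotR x (Q y)) ->
  exists c : R, [/\ 0 <= c, forall x, nrm (P x) ^+ 2 <= c * nrm x ^+ 2 &
    ~ invertible (c%:C *: idfun - (Q \o P))].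
Proof.
move=> x00 hP hQ PQ.
have [_ [k [k0 hk]]] := iffLR (bounded_operatorP _) hP.
pose E := [set c : R | forall x, nrm (P x) ^+ 2 <= c * nrm x ^+ 2].
have nx0 : 0 < nrm x0.
  by rewrite lt0r nrm_ge0 andbT; apply: contraNneq x00 => /nrm_eq0 ->.
have E0 : lbound E 0.
  move=> c /(_ x0) cx0; rewrite -(pmulr_lge0 _ (exprn_gt0 2 nx0)).
  exact: le_trans (sqr_ge0 _) cx0.
have EN : E !=set0.
  exists (k ^+ 2) => x; rewrite -exprMn ler_sqr ?nnegrE ?nrm_ge0//.
  by rewrite mulr_ge0 ?nrm_ge0// ltW.
pose c := inf E; have c0 : 0 <= c by exact: lb_le_inf.
have Ec : E c.
  move=> x; have [xe|xn] := eqVneq (nrm x) 0.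
    by rewrite (nrm_eq0 xe) (bounded0 hP) nrm0 expr0n mulr0.
  have nx : 0 < nrm x ^+ 2 by rewrite exprn_gt0// lt0r xn nrm_ge0.
  rewrite -ler_pdivrMr//; apply: lb_le_inf => // d Ed.
  by rewrite ler_pdivrMr.
(* The adjoint obeys the same bound, because [|Q y|^2] is the form of [P (Q y)] against [y]. *)
have Qc y : nrm (Q y) ^+ 2 <= c * nrm y ^+ 2.
  have [ye|yn] := eqVneq (nrm (Q y)) 0.
    by rewrite ye expr0n mulr_ge0// sqr_ge0.
  have ny : 0 < nrm (Q y) ^+ 2 by rewrite exprn_gt0// lt0r yn nrm_ge0.
  have h1 : nrm (Q y) ^+ 2 <= nrm (P (Q y)) * nrm y.
    by rewrite -(rdotxx dot_norm) -PQ (rdot_le dot_norm).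
  have h2 : (nrm (Q y) ^+ 2) ^+ 2 <= (nrm (P (Q y)) * nrm y) ^+ 2.
    by rewrite ler_sqr ?nnegrE ?sqr_ge0// mulr_ge0 ?nrm_ge0.
  rewrite -(ler_pM2l ny) -expr2 (le_trans h2)// exprMn.
  have := ler_wpM2r (sqr_ge0 (nrm y)) (Ec (Q y)); lra.
have Dc x : nrm ((c%:C *: idfun - (Q \o P)) x) ^+ 2 <= c * (c * nrm x ^+ 2 - nrm (P x) ^+ 2).
  rewrite !opE /= (nrmB_sqr dot_norm) rdotZl -PQ (rdotxx dot_norm) nrmZ nrmC ger0_norm//.
  have := Qc (P x); lra.
exists c; split=> // -[S [hS _ SD]].
have [_ [j [j0 hj]]] := iffLR (bounded_operatorP _) hS.
(* An inverse of norm at most [j] would leave room below [c]: this estimate makes [c - 1 / (j^2 c)]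
   admissible too, against the choice of [c] as an infimum. *)
have lower x : nrm x ^+ 2 <= j ^+ 2 * c * (c * nrm x ^+ 2 - nrm (P x) ^+ 2).
  have h1 : nrm x <= j * nrm ((c%:C *: idfun - (Q \o P)) x).
    by rewrite -{1}[x](congr1 (@^~ x) SD) hj.
  have h2 : nrm x ^+ 2 <= (j * nrm ((c%:C *: idfun - (Q \o P)) x)) ^+ 2.
    by rewrite ler_sqr ?nnegrE ?nrm_ge0// (le_trans _ h1)// nrm_ge0.
  apply: le_trans h2 _; rewrite exprMn -mulrA; apply: ler_wpM2l; first exact: sqr_ge0.
  exact: Dc.
have cp : 0 < c.
  rewrite lt0r c0 andbT; apply/eqP => ce; have := lower x0.
  by rewrite ce mulr0 mul0r leNgt exprn_gt0.
pose b := j ^+ 2 * c; have b0 : 0 < b by rewrite mulr_gt0// exprn_gt0.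
have : c <= c - b^-1.
  apply: ge_inf; first by exists 0.
  move=> x; have := lower x; rewrite -/b -(ler_pM2l (_ : 0 < b^-1)) ?invr_gt0//.
  by rewrite [leRHS]mulrA mulVf ?gt_eqF// mul1r; lra.
by rewrite lerBDr gerDl leNgt invr_gt0 b0.
Qed.

Section SelfAdjoint.
Context {A : H -> H} (A_sa : selfadjoint dot A).

Lemma spectrum_bounded : exists k : R,
  forall z, spectrum A z -> exists2 t : R, z = t%:C & - k <= t <= k.
Proof.
have [_ [k [k0 hk]]] := iffLR (bounded_operatorP _) A_sa.1.
have hkx x : nrm x * nrm (A x) <= k * nrm x ^+ 2.
  by have := ler_wpM2l (nrm_ge0 x) (hk x); rewrite expr2 mulrCA.
exists k => z; apply: (spectrum_itv dot_norm A_sa) => x.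
- have := rdot_le dot_norm x (- A x); rewrite rdotNr nrmN.
  have := hkx x; lra.
- exact: le_trans (rdot_le dot_norm _ _) (hkx x).
Qed.

Lemma spectrum_real z : spectrum A z -> exists t : R, z = t%:C.
Proof. by have [k sp] := spectrum_bounded => /sp[t -> _]; exists t. Qed.

Lemma horner_spectrum_bounded p : exists F : R, forall z, spectrum A z -> nrm p.[z] <= F.
Proof.
have [k sp] := spectrum_bounded.
elim/poly_ind: p => [|p c [F hF]]; first by exists 0 => z _; rewrite horner0 nrm0.
exists (F * k + nrm c) => z spz; rewrite !hornerE; apply: le_trans (ler_nrmD _ _) _.
rewrite lerD2r nrmM ler_pM ?nrm_ge0 ?hF//.
by have [t -> tk] := sp z spz; rewrite nrmC ler_norml.
Qed.

Lemma horner_map_conjc p z : spectrum A z -> (map_poly conjc p).[z] = (p.[z])^*.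
Proof. by move=> /spectrum_real[t ->]; rewrite -{1}conjc_real horner_map. Qed.

(** Taking [P = Q = A] makes [c - A^2] not invertible, and [c - X^2] is a nonzero polynomial, so it
    has a spectral root. *)
Lemma spectrum_nonempty x : x != 0 -> spectrum A !=set0.
Proof.
move=> x0; have [hA sA] := iffLR (selfadjointP _ _) A_sa.
have [c [_ _ Nc]] := best_bound_not_invertible x0 hA hA sA.
have [||z spz _] := @not_invertible_root _ _ A (c%:C%:P - 'X * 'X) hA.
- apply/eqP => /(congr1 (fun p : {poly R[i]} => p`_2)).
  by rewrite coefB coefC coefXM coefX coef0 sub0r => /eqP; rewrite oppr_eq0 oner_eq0.
- by rewrite poly_opB poly_opM// poly_opC !poly_opX.
- by exists z.
Qed.

Lemma norm_poly_op_attained p x0 : x0 != 0 ->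
  exists2 z, spectrum A z & forall x, nrm (poly_op p A x) <= nrm p.[z] * nrm x.
Proof.
move=> x00; have hA := A_sa.1.
have [c [c0 hc]] := best_bound_not_invertible x00 (bounded_poly_op hA p)
  (bounded_poly_op hA (map_poly conjc p))
  (fun x y => congr1 (@complex.Re R) (dot_poly_op p x y A_sa)).
rewrite -poly_opM// -(poly_opC _ A) -poly_opB => Nc.
set q := c%:C%:P - _ in Nc.
suff [z spz qz] : exists2 z, spectrum A z & root q z.
  exists z => // x; move: qz; rewrite /root !hornerE horner_map_conjc// subr_eq0.
  rewrite mulrC -sqr_normc nrmE -rmorphXn => /eqP/complexI cE.
  have := hc x; rewrite cE -exprMn ler_sqr ?nnegrE ?mulr_ge0 ?nrm_ge0//.
(* If [c - p^* p] is the zero polynomial, factoring yields nothing, but then every spectral point is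
   a root and one exists. *)
have [q0|q0] := eqVneq q 0; last exact: not_invertible_root Nc.
by have [z spz] := spectrum_nonempty x00; exists z => //; rewrite q0 root0.
Qed.

Lemma norm_poly_op_le p (e : R) : (forall z, spectrum A z -> nrm p.[z] <= e) ->
  forall x, nrm (poly_op p A x) <= e * nrm x.
Proof.
move=> pe x; have [->|x0] := eqVneq x 0.
  by rewrite (bounded0 (bounded_poly_op A_sa.1 p)) nrm0 mulr0.
have [z spz hz] := norm_poly_op_attained p x0.
by rewrite (le_trans (hz x))// ler_wpM2r ?nrm_ge0// pe.
Qed.

End SelfAdjoint.

End SpectralNorm.

(** * Continuous functional calculus *)

Lemma ler_add_eps {R : realFieldType} (a b c : R) : 0 <= c ->
  (forall d, 0 < d -> a <= b + d * c) -> a <= b.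
Proof.
move=> c0 h; apply/ler_addgt0Pr => e e0.
have c1 : 0 < c + 1 by rewrite ltr_wpDl.
apply: le_trans (h _ (divr_gt0 e0 c1)) _; rewrite lerD2l mulrAC ler_pdivrMr//.
by rewrite ler_pM2l//; lra.
Qed.

Lemma exists_small {R : realFieldType} (D e : R) : 0 <= D -> 0 < e ->
  exists d, [/\ 0 < d, d <= 1 & d * D <= e].
Proof.
move=> D0 e0; have De : 0 < D + e by lra.
exists (e / (D + e)); split; first exact: divr_gt0.
  by rewrite ler_pdivrMr// mul1r; lra.
by rewrite mulrAC ler_pdivrMr// ler_pM2l//; lra.
Qed.

Lemma nrm_conjc {R : realType} (a : R[i]) : nrm (conjc a) = nrm a.
Proof. by rewrite /nrm normcJ. Qed.

Section FunctionalCalculus.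
Context {R : realType} {H : completeNormedModType R[i]} (dot : {dot H for Num.conj}).
Hypothesis dot_norm : forall x : H, dot x x = `|x| ^+ 2.
Implicit Types (A T S : H -> H) (x y : H) (f : R[i] -> R[i]) (p : {poly R[i]}) (g : R -> R).
Local Notation dotR := (rdot dot).

(** One polynomial for each tolerance replaces the sequence; conversely, choosing one for each
    [1 / (n + 1)] rebuilds it. *)
Lemma is_cfcP A f T : is_cfc A f T <-> bounded_operator T /\
  forall e : R, 0 < e -> exists p, (forall z, spectrum A z -> nrm (p.[z] - f z) <= e) /\
    forall x, nrm (poly_op p A x - T x) <= e * nrm x.
Proof.
split=> -[hT]; last first.
  move=> hp; split=> //.
  have d0 (n : nat) : 0 < n.+1%:R^-1 :> R by rewrite invr_gt0 ltr0n.
  have [p hpn] := choice (fun n => hp _ (d0 n)).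
  exists p; split=> e e0; near=> n; have ne : n.+1%:R^-1 <= e :> R.
  - by apply/ltW; near: n; exact: near_infty_natSinv_lt (PosNum e0).
  - by move=> z /((hpn n).1 z); rewrite nrmE lecR => /le_trans; apply.
  - by apply/ltW; near: n; exact: near_infty_natSinv_lt (PosNum e0).
  - move=> x; have := (hpn n).2 x; rewrite !nrmE -rmorphM lecR => /le_trans; apply.
    by rewrite ler_wpM2r ?nrm_ge0.
move=> [p [pf pT]]; split=> // e e0.
near \oo => n; exists (p n); split.
  move=> z spz; rewrite -lecR -nrmE; move: z spz; near: n; exact: pf.
move=> x; rewrite -lecR rmorphM/= -!nrmE; move: x; near: n; exact: pT.
Unshelve. all: end_near. Qed.

Section Calculus.
Context {A : H -> H} (A_sa : selfadjoint dot A).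

(** Compare [p] with a polynomial [q] that is [d]-close to both [f] and [T]: [p - q] is at most
    [e + d] on the spectrum, so the norm bound applies, and [d] tends to 0. *)
Lemma cfc_near f T p (e : R) : is_cfc A f T ->
  (forall z, spectrum A z -> nrm (p.[z] - f z) <= e) ->
  forall x, nrm (poly_op p A x - T x) <= e * nrm x.
Proof.
move=> /is_cfcP[hT approx] pf x.
apply: (@ler_add_eps _ _ _ (2 * nrm x)); first by rewrite mulr_ge0 ?nrm_ge0.
move=> d d0; have [q [qf qT]] := approx d d0.
have : nrm (poly_op (p - q) A x) <= (e + d) * nrm x.
  apply: (norm_poly_op_le dot_norm A_sa) => z spz; rewrite !hornerE.
  apply: le_trans (ler_nrm_dist (f z) _ _) _; apply: lerD; first exact: pf.
  by rewrite nrmB qf.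
rewrite poly_opB opE => h1; have := qT x.
have := ler_nrm_dist (poly_op q A x) (poly_op p A x) (T x); rewrite !opE in h1 *.
lra.
Qed.

Lemma cfc_le f T (e : R) : is_cfc A f T ->
  (forall z, spectrum A z -> nrm (f z) <= e) -> forall x, nrm (T x) <= e * nrm x.
Proof.
move=> fT fe x; rewrite -nrmN -sub0r.
have -> : 0 = poly_op (0%:P : {poly R[i]}) A x by rewrite poly_opC opE scale0r.
by apply: (cfc_near fT) => z spz; rewrite hornerC sub0r nrmN fe.
Qed.

Lemma cfc_uniq f T S : is_cfc A f T -> is_cfc A f S -> T = S.
Proof.
move=> fT /is_cfcP[_ fS]; apply/funext => x; apply/eqP; rewrite -subr_eq0.
apply/eqP/nrm_eq0/eqP; rewrite eq_le nrm_ge0 andbT.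
apply: (@ler_add_eps _ _ _ (2 * nrm x)); first by rewrite mulr_ge0 ?nrm_ge0.
move=> d d0; have [p [pf pS]] := fS d d0.
have := cfc_near fT pf x; rewrite nrmB; have := pS x.
have := ler_nrm_dist (poly_op p A x) (T x) (S x); lra.
Qed.

Lemma cfc_poly p : is_cfc A (horner p) (poly_op p A).
Proof.
apply/is_cfcP; split; first exact: bounded_poly_op A_sa.1 p.
move=> e e0; exists p; split=> [z _|x]; first by rewrite subrr nrm0 ltW.
by rewrite subrr nrm0 mulr_ge0 ?nrm_ge0// ltW.
Qed.

Lemma cfc_ext f f' T : (forall z, spectrum A z -> f z = f' z) ->
  is_cfc A f T -> is_cfc A f' T.
Proof.
move=> ff' /is_cfcP[hT approx]; apply/is_cfcP; split=> // e /approx[p [pf pT]].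
by exists p; split=> // z spz; rewrite -ff'// pf.
Qed.

Lemma cfc_add f f' T S : is_cfc A f T -> is_cfc A f' S ->
  is_cfc A (fun z => f z + f' z) (T + S).
Proof.
move=> /is_cfcP[hT fT] /is_cfcP[hS fS]; apply/is_cfcP; split; first exact: bounded_add.
move=> e e0; have e2 : 0 < e / 2 by lra.
have [p [pf pT]] := fT _ e2; have [q [qf qS]] := fS _ e2.
exists (p + q); split=> [z spz|x].
  rewrite hornerD opprD addrACA; apply: le_trans (ler_nrmD _ _) _.
  by have := pf z spz; have := qf z spz; lra.
rewrite poly_opD !opE opprD addrACA; apply: le_trans (ler_nrmD _ _) _.
by have := pT x; have := qS x; lra.
Qed.

Lemma cfc_scale (a : R[i]) f T : is_cfc A f T ->
  is_cfc A (fun z => a * f z) (a *: T).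
Proof.
move=> /is_cfcP[hT fT]; apply/is_cfcP; split; first exact: bounded_scale.
move=> e e0; have [d [d0 _ de]] := exists_small (nrm_ge0 a) e0.
have [p [pf pT]] := fT _ d0; exists (a *: p); split=> [z spz|x].
  rewrite hornerZ -mulrBr nrmM; apply: le_trans de; rewrite mulrC.
  by rewrite ler_wpM2r ?nrm_ge0 ?pf.
rewrite poly_opZ !opE -scalerBr nrmZ.
apply: (@le_trans _ _ (nrm a * (d * nrm x))); first by rewrite ler_wpM2l ?nrm_ge0 ?pT.
by rewrite mulrA [nrm a * d]mulrC ler_wpM2r ?nrm_ge0.
Qed.

Lemma cfc_bounded f T : is_cfc A f T ->
  exists F : R, forall z, spectrum A z -> nrm (f z) <= F.
Proof.
move=> /is_cfcP[_ /(_ 1 ltr01)[p [pf _]]].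
have [F hF] := horner_spectrum_bounded dot_norm A_sa p; exists (1 + F) => z spz.
rewrite -[f z](subrK p.[z]); apply: le_trans (ler_nrmD _ _) _.
by rewrite nrmB lerD ?pf ?hF.
Qed.

Lemma cfc_mul f f' T S : is_cfc A f T -> is_cfc A f' S ->
  is_cfc A (fun z => f z * f' z) (T \o S).
Proof.
move=> fT0 fS0; have [F fF] := cfc_bounded fT0; have [F' fF'] := cfc_bounded fS0.
have /is_cfcP[hT fT] := fT0; have /is_cfcP[hS fS] := fS0.
have [_ [k [k0 hk]]] := iffLR (bounded_operatorP _) hT.
have [_ [j [j0 hj]]] := iffLR (bounded_operatorP _) hS.
apply/is_cfcP; split=> [|e e0]; first exact: bounded_comp.
(* One constant dominates the factor of [d] in both product estimates, on the spectrum and for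
   operators. Absolute values appear because bounds over a possibly empty spectrum carry no sign. *)
have D0 : 0 <= `|F| + `|F'| + k + j + 1.
  by have := normr_ge0 F; have := normr_ge0 F'; lra.
have [d [d0 d1 de]] := exists_small D0 e0.
have [p [pf pT]] := fT _ d0; have [q [qf qS]] := fS _ d0.
exists (p * q); split=> [z spz|x].
  have -> : (p * q).[z] - f z * f' z = (p.[z] - f z) * q.[z] + f z * (q.[z] - f' z).
    by rewrite hornerM; ring.
  apply: le_trans (ler_nrmD _ _) _; rewrite !nrmM.
  have qz : nrm q.[z] <= F' + 1.
    have := ler_nrmD (q.[z] - f' z) (f' z); rewrite subrK.
    by have := qf z spz; have := fF' z spz; lra.
  have h1 := ler_pM (nrm_ge0 _) (nrm_ge0 _) (pf z spz) qz.
  have h2 := ler_pM (nrm_ge0 _) (nrm_ge0 _) (fF z spz) (qf z spz).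
  have h3 : d * (F + F' + 1) <= d * (`|F| + `|F'| + k + j + 1).
    by rewrite ler_wpM2l ?(ltW d0)//; have := ler_norm F; have := ler_norm F'; lra.
  lra.
have -> : poly_op (p * q) A x - (T \o S) x =
    (poly_op p A (poly_op q A x) - T (poly_op q A x)) + T (poly_op q A x - S x).
  by rewrite (poly_opM A_sa.1) /= (boundedB hT) addrA subrK.
apply: le_trans (ler_nrmD _ _) _.
have qx : nrm (poly_op q A x) <= (j + 1) * nrm x.
  have := ler_nrmD (poly_op q A x - S x) (S x); rewrite subrK.
  have := qS x; have := hj x; have := ler_wpM2r (nrm_ge0 x) d1; lra.
have h1 := le_trans (pT (poly_op q A x)) (ler_wpM2l (ltW d0) qx).
have h2 := le_trans (hk (poly_op q A x - S x)) (ler_wpM2l (ltW k0) (qS x)).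
have h3 : d * (k + j + 1) <= d * (`|F| + `|F'| + k + j + 1).
  by rewrite ler_wpM2l ?(ltW d0)//; have := normr_ge0 F; have := normr_ge0 F'; lra.
have h4 := ler_wpM2r (nrm_ge0 x) (le_trans h3 de); lra.
Qed.

(** For [g] a real power, this is by conversion the function used in [op_powR]. *)
Definition real_fun g (z : R[i]) : R[i] := (g (complex.Re z))%:C.

(** On the real spectrum, conjugating the coefficients of [p] conjugates its values. As the function
    is real there, the adjoint polynomials approximate it equally well, so they also converge to
    [T]. *)
Lemma cfc_selfadjoint g T : is_cfc A (real_fun g) T -> selfadjoint dot T.
Proof.
move=> gT; have /is_cfcP[hT approx] := gT; apply/selfadjointP; split=> //.
suff half x y : dotR (T x) y <= dotR x (T y).
  by move=> x y; apply/eqP; rewrite eq_le half [dotR x _]rdotC [dotR _ y]rdotC half.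
apply: (@ler_add_eps _ _ _ (2 * (nrm x * nrm y))); first by rewrite !mulr_ge0 ?nrm_ge0.
move=> d d0; have [p [pg pT]] := approx d d0.
have p'T : nrm (poly_op (map_poly conjc p) A y - T y) <= d * nrm y.
  apply: cfc_near gT _ y => z spz; rewrite (horner_map_conjc dot_norm A_sa)//.
  have -> : real_fun g z = conjc (real_fun g z) by rewrite conjc_real.
  by rewrite -(rmorphB (@conjc R)) nrm_conjc; exact: pg.
have h1 := rdot_le dot_norm (T x - poly_op p A x) y.
have h2 := rdot_le dot_norm x (poly_op (map_poly conjc p) A y - T y).
have e1 : dotR (poly_op p A x) y = dotR x (poly_op (map_poly conjc p) A y).
  by rewrite /rdot dot_poly_op.
rewrite rdotBl e1 nrmB in h1; rewrite rdotBr in h2.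
have h3 := ler_wpM2r (nrm_ge0 y) (pT x).
have h4 := ler_wpM2l (nrm_ge0 x) p'T; lra.
Qed.

(** From [0 <= g <= J] on the spectrum comes [|J x - T x| <= J |x|]. Squaring leaves [|T x|^2] at
    most [2 J] times the form of [T] at [x]. *)
Lemma cfc_ge0 g T : is_cfc A (real_fun g) T ->
  (forall z, spectrum A z -> 0 <= g (complex.Re z)) ->
  forall x, 0 <= dotR x (T x).
Proof.
move=> gT g0 x; have [K gK] := cfc_bounded gT.
pose J := `|K| + 1; have J0 : 0 < J by rewrite ltr_wpDl.
have JT : is_cfc A (fun z => J%:C%:P.[z] + (-1) * real_fun g z)
    (poly_op J%:C%:P A + (-1) *: T).
  by apply: cfc_add; [exact: cfc_poly|exact: cfc_scale].
have /(_ J)/(_ _ x) h := cfc_le JT.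
have : nrm (J%:C *: x - T x) <= J * nrm x.
  have := h _; rewrite poly_opC !opE /= scaleN1r; apply=> z spz.
  rewrite hornerC mulN1r -rmorphB /= nrmC.
  have := gK z spz; rewrite nrmC ger0_norm ?g0// => gzK.
  rewrite ler_norml; apply/andP; split; have := g0 z spz; have := ler_norm K; rewrite /J; lra.
rewrite -ler_sqr ?nnegrE ?nrm_ge0//; last by rewrite mulr_ge0 ?nrm_ge0// ltW.
rewrite (nrmB_sqr dot_norm) rdotZl nrmZ nrmC (gtr0_norm J0) => h1.
have h2 := sqr_ge0 (nrm (T x)).
have : 0 <= J * dotR x (T x) by lra.
by rewrite pmulr_rge0.
Qed.

Lemma cfc_form_le g g' T S : is_cfc A (real_fun g) T -> is_cfc A (real_fun g') S ->
  (forall z, spectrum A z -> g (complex.Re z) <= g' (complex.Re z)) ->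
  forall x, dotR x (T x) <= dotR x (S x).
Proof.
move=> gT g'S gg' x.
have : is_cfc A (real_fun (fun t => g' t - g t)) (S + (-1) *: T).
  apply: cfc_ext (cfc_add g'S (cfc_scale (-1) gT)) => z _.
  by rewrite /real_fun rmorphB mulN1r.
move=> /cfc_ge0/(_ _ x); rewrite scaleN1r !opE rdotBr subr_ge0; apply=> z spz.
by rewrite subr_ge0 gg'.
Qed.

Lemma cfc_exists g (a b : R) :
  (forall z, spectrum A z -> exists2 t : R, z = t%:C & a <= t <= b) ->
  (forall e : R, 0 < e -> exists p : {poly R}, forall t, a <= t <= b -> `|p.[t] - g t| <= e) ->
  exists T, is_cfc A (real_fun g) T.
Proof.
move=> spA approx.
have d0 (n : nat) : 0 < n.+1%:R^-1 :> R by rewrite invr_gt0 ltr0n.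
have [p0 hp0] := choice (fun n => approx _ (d0 n)).
pose p n : {poly R[i]} := map_poly (real_complex R) (p0 n).
have pg n z : spectrum A z -> nrm ((p n).[z] - real_fun g z) <= n.+1%:R^-1.
  by move=> /spA[t -> tab]; rewrite horner_map -rmorphB /= nrmC hp0.
(* The rate is proportional to [|x|], so the pointwise limits are limits in operator norm. *)
have cauchy x n m : (n <= m)%N ->
    nrm (poly_op (p m) A x - poly_op (p n) A x) <= n.+1%:R^-1 * (2 * nrm x).
  move=> nm; rewrite -op_oppE -op_addE -poly_opB mulrA.
  apply: (norm_poly_op_le dot_norm A_sa) => z spz; rewrite !hornerE.
  apply: le_trans (ler_nrm_dist (real_fun g z) _ _) _.
  rewrite [X in _ + X <= _]nrmB; have := pg n z spz; have := pg m z spz.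
  have : m.+1%:R^-1 <= n.+1%:R^-1 :> R by rewrite lef_pV2 ?posrE ?ltr0n// ler_nat.
  move: (_^-1) (_^-1) => u v; lra.
have small (D d : R) : 0 <= D -> 0 < d -> exists n, n.+1%:R^-1 * D <= d.
  move=> D0 dd; have [e [e0 _ eD]] := exists_small D0 dd.
  near \oo => n; exists n; apply: le_trans eD; rewrite ler_wpM2r// ltW//.
  by near: n; exact: near_infty_natSinv_lt (PosNum e0).
have [T hT] := choice (fun x => cauchy_seq_cvg (cauchy x)
  (fun d => small _ d (mulr_ge0 (ler0n R 2) (nrm_ge0 x)))).
have hp n := bounded_poly_op A_sa.1 (p n).
have linT : linear T.
  move=> c x y; apply/eqP; rewrite -subr_eq0; apply/eqP/nrm_eq0/eqP.
  rewrite eq_le nrm_ge0 andbT; apply/ler_addgt0Pr => e e0; rewrite add0r.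
  pose D := 2 * nrm (c *: x + y) + nrm c * (2 * nrm x) + 2 * nrm y.
  have D0 : 0 <= D by rewrite !addr_ge0// ?mulr_ge0// ?mulr_ge0 ?nrm_ge0.
  have [n hn] := small D e D0 e0; apply: le_trans hn.
  have h1 := hT (c *: x + y) n.
  have h2 := ler_wpM2l (nrm_ge0 c) (hT x n); rewrite -nrmZ scalerBr in h2.
  have h3 := hT y n.
  have := ler_nrm_dist (poly_op (p n) A (c *: x + y)) (T (c *: x + y)) (c *: T x + T y).
  rewrite (boundedD (hp n)) (boundedZ (hp n)) in h1 *.
  have h4 := ler_nrmD (c *: T x - c *: poly_op (p n) A x) (T y - poly_op (p n) A y).
  rewrite addrACA -opprD nrmB in h4.
  by move: (n.+1%:R^-1) h1 h2 h3 => w h1 h2 h3 h5; rewrite /D; lra.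
exists T; apply/is_cfcP; split.
  apply/bounded_operatorP; split=> //.
  have [_ [k [k0 hk]]] := iffLR (bounded_operatorP _) (hp 0%N).
  exists (k + 2); split=> [|x]; first lra.
  have := hT x 0%N; have := hk x.
  have := ler_nrmD (T x - poly_op (p 0%N) A x) (poly_op (p 0%N) A x); rewrite subrK invr1.
  lra.
move=> e e0; have [n hn] := small 2 e (ler0n R 2) e0.
exists (p n); split=> [z spz|x].
  by have := pg n z spz; have := d0 n; move: (n.+1%:R^-1) hn => w hn; lra.
rewrite nrmB; apply: le_trans (hT x n) _; rewrite mulrA.
by rewrite ler_wpM2r ?nrm_ge0.
Unshelve. all: end_near. Qed.

End Calculus.

End FunctionalCalculus.

(** * Powers and the geometric mean *)

Section OperatorPowers.
Context {R : realType} {H : completeNormedModType R[i]} (dot : {dot H for Num.conj}).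
Hypothesis dot_norm : forall x : H, dot x x = `|x| ^+ 2.
Implicit Types (A B S T V : H -> H) (x y : H).
Local Notation dotR := (rdot dot).

Lemma op_powR_cfc (m K a : R) A : 0 < m -> selfadjoint dot A ->
  (forall z, spectrum A z -> exists2 t : R, z = t%:C & m <= t <= K) ->
  is_cfc A (real_fun (fun t => t `^ a)) (op_powR A a).
Proof.
move=> m0 sA spA; apply: (getPex (cfc_exists dot_norm sA spA _)) => e e0.
(* When the spectrum is empty, nothing prevents [K < m]; the approximation claim is then vacuous. *)
have [mK|Km] := leP m K; first exact: powR_poly_approx.
by exists 0 => t /andP[mt tK]; lra.
Qed.

Lemma op_powR_half (m K : R) A : 0 < m -> selfadjoint dot A ->
  (forall z, spectrum A z -> exists2 t : R, z = t%:C & m <= t <= K) ->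
  [/\ selfadjoint dot (op_powR A 2^-1), selfadjoint dot (op_powR A (- 2^-1)),
      op_powR A 2^-1 \o op_powR A 2^-1 = A,
      op_powR A 2^-1 \o op_powR A (- 2^-1) = idfun &
      op_powR A (- 2^-1) \o op_powR A 2^-1 = idfun].
Proof.
move=> m0 sA spA.
have hT := op_powR_cfc 2^-1 m0 sA spA; have hV := op_powR_cfc (- 2^-1) m0 sA spA.
have id_cfc : is_cfc A (fun=> 1) idfun.
  have -> : idfun = poly_op 1%:P A by rewrite poly_opC scale1r.
  by apply: cfc_ext (cfc_poly sA _) => z _; rewrite hornerC.
have mulE (a b : R) z : spectrum A z ->
    real_fun (fun t => t `^ a) z * real_fun (fun t => t `^ b) z =
    (complex.Re z `^ (a + b))%:C.
  move=> /spA[t -> /andP[mt _]] /=; rewrite /real_fun -rmorphM /= powRD//.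
  (* When [a + b = 0] the exponent law may fail at base 0; here [0 < m <= t]. *)
  by apply/implyP => _; lra.
split.
- exact: cfc_selfadjoint hT.
- exact: cfc_selfadjoint hV.
- apply: (cfc_uniq dot_norm sA (f := horner 'X)); last by have := cfc_poly sA 'X; rewrite poly_opX.
  apply: cfc_ext (cfc_mul dot_norm sA hT hT) => z spz; rewrite mulE// hornerX.
  have [t -> /andP[mt _]] := spA z spz; have -> : 2^-1 + 2^-1 = 1 :> R by lra.
  by rewrite powRr1//=; lra.
- apply: (cfc_uniq dot_norm sA _ id_cfc); apply: cfc_ext (cfc_mul dot_norm sA hT hV).
  by move=> z spz; rewrite mulE// subrr powRr0.
- apply: (cfc_uniq dot_norm sA _ id_cfc); apply: cfc_ext (cfc_mul dot_norm sA hV hT).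
  by move=> z spz; rewrite mulE// addNr powRr0.
Qed.

Lemma positive_operator_trivial A : (forall x : H, x = 0) -> positive_operator dot A.
Proof.
move=> x0; apply/positive_operatorP; split=> [|x]; last by rewrite (x0 x) /rdot linear0l.
apply/selfadjointP; split=> [|x y]; last by rewrite (x0 x) (x0 y) (x0 (A 0)).
apply/bounded_operatorP; split=> [a x y|]; first by rewrite [LHS]x0 [RHS]x0.
by exists 1; split=> // x; rewrite (x0 x) (x0 (A 0)) nrm0 mulr0.
Qed.

Section GeometricMean.
Context (l m M : R) (A B : H -> H).
Hypotheses (l01 : 0 <= l <= 1) (m_gt0 : 0 < m)
  (A_sa : selfadjoint dot A) (B_sa : selfadjoint dot B)
  (mA : op_le dot (m%:C *: idfun) A) (AB : op_le dot A B)
  (BM : op_le dot B (M%:C *: idfun)).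

(** A nonzero vector gives [m <= M]. The bounds concern forms at one vector, and self-adjointness of
    the mean is what lifts them to the operator order. *)
Lemma geometric_mean_form_bounds : (exists x : H, x != 0) ->
  selfadjoint dot (geometric_mean l A B) /\
  forall x, let a := dotR x ((((1 - l)%:C *: A + l%:C *: B) : H -> H) x) in
    let g := dotR x (geometric_mean l A B x) in
    [/\ g <= a, a <= expR (l * (1 - l) * (1 - M / m) ^+ 2) * g &
        a <= g + l * (1 - l) * ln (M / m) ^+ 2 * dotR x (B x)].
Proof.
move=> [x0 x00].
have sI (a : R) : selfadjoint dot (a%:C *: idfun).
  by apply: selfadjoint_scale; exact: selfadjoint_id.
have mA' x : m * nrm x ^+ 2 <= dotR x (A x).
  by have /(op_leP (sI m) A_sa)/(_ x) := mA; rewrite opE rdotZr (rdotxx dot_norm).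
have AB' x : dotR x (A x) <= dotR x (B x) by have /(op_leP A_sa B_sa)/(_ x) := AB.
have BM' x : dotR x (B x) <= M * nrm x ^+ 2.
  by have /(op_leP B_sa (sI M))/(_ x) := BM; rewrite opE rdotZr (rdotxx dot_norm).
have nx0 : 0 < nrm x0 ^+ 2.
  by rewrite exprn_gt0// lt0r nrm_ge0 andbT; apply: contraNneq x00 => /nrm_eq0 ->.
have mM : m <= M.
  by rewrite -(ler_pM2r nx0); apply: le_trans (mA' x0) (le_trans (AB' x0) (BM' x0)).
have spA := spectrum_itv dot_norm A_sa mA' (fun x => le_trans (AB' x) (BM' x)).
have [sT sV TT TV VT] := op_powR_half m_gt0 A_sa spA.
rewrite /geometric_mean; set T := op_powR A 2^-1 in sT TT TV VT *.
set V := op_powR A (- 2^-1) in sV TV VT *.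
have {}TT x : T (T x) = A x by rewrite -[in RHS]TT.
have {}TV x : T (V x) = x by exact: (congr1 (@^~ x) TV).
have {}VT x : V (T x) = x by exact: (congr1 (@^~ x) VT).
set X := V \o B \o V; have sX : selfadjoint dot X by exact: selfadjoint_conj.
have rT x y : dotR (T x) y = dotR x (T y) by have [_ ->] := iffLR (selfadjointP _ _) sT.
have rV x y : dotR (V x) y = dotR x (V y) by have [_ ->] := iffLR (selfadjointP _ _) sV.
have AV x : dotR (V x) (A (V x)) = nrm x ^+ 2.
  by rewrite -TT TV rV VT (rdotxx dot_norm).
have X1 x : 1 * nrm x ^+ 2 <= dotR x (X x).
  by rewrite mul1r /X /= -rV -AV.
(* The form of [X] at [x] is that of [B] at [V x], at most [M |V x|^2], while [m |V x|^2] is at most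
   the form of [A] at [V x], which is [|x|^2]. *)
have Xh x : dotR x (X x) <= M / m * nrm x ^+ 2.
  rewrite /X /= -rV; apply: le_trans (BM' (V x)) _.
  rewrite -mulrA; apply: ler_wpM2l; first exact: le_trans (ltW m_gt0) mM.
  by rewrite ler_pdivlMl// -(AV x).
have spX := spectrum_itv dot_norm sX X1 Xh.
have hP := op_powR_cfc l ltr01 sX spX; set P := op_powR X l in hP *.
have sP := cfc_selfadjoint dot_norm sX hP.
pose W := (1 - l)%:C *: idfun + l%:C *: X.
have hW : is_cfc X (real_fun (fun t => 1 - l + l * t)) W.
  have -> : W = poly_op ((1 - l)%:C%:P + l%:C *: 'X) X.
    by rewrite poly_opD poly_opC poly_opZ poly_opX.
  apply: cfc_ext (cfc_poly sX _) => z /spX[t -> _].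
  by rewrite !hornerE /real_fun /= [RHS](rmorphD _ (1 - l)) rmorphM.
have hX : is_cfc X (real_fun id) X.
  have -> : is_cfc X (real_fun id) X = is_cfc X (real_fun id) (poly_op 'X X).
    by rewrite poly_opX.
  by apply: cfc_ext (cfc_poly sX _) => z /spX[t -> _]; rewrite hornerX.
have scaleR (a : R) g S : is_cfc X (real_fun g) S ->
    is_cfc X (real_fun (fun t => a * g t)) (a%:C *: S).
  by move=> hS; apply: cfc_ext (cfc_scale a%:C hS) => z _; rewrite /real_fun rmorphM.
have addR g g' S S' : is_cfc X (real_fun g) S -> is_cfc X (real_fun g') S' ->
    is_cfc X (real_fun (fun t => g t + g' t)) (S + S').
  by move=> hS hS'; apply: cfc_ext (cfc_add hS hS') => z _; rewrite /real_fun rmorphD.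
split; first exact: selfadjoint_conj.
have bT := sT.1.
move=> x.
(* Since [A = T T], [B = T X T] and [T] is self-adjoint, each form at [x] becomes the form of a
   function of [X] at [T x]. *)
have -> : dotR x ((((1 - l)%:C *: A + l%:C *: B) : H -> H) x) = dotR (T x) (W (T x)).
  rewrite rT /W !opE (boundedD bT) !(boundedZ bT) /X /= TT TV VT.
  by rewrite !rdotDr !rdotZr.
have -> : dotR x ((T \o P \o T) x) = dotR (T x) (P (T x)) by rewrite rT.
have -> : dotR x (B x) = dotR (T x) (X (T x)) by rewrite rT /X /= TV VT.
split.
- apply: (cfc_form_le dot_norm sX hP hW) => z /spX[t -> /andP[t1 _]] /=.
  by apply: powR_le_affine => //; lra.
- rewrite -rdotZr; apply: (cfc_form_le dot_norm sX hW (scaleR _ _ _ hP)).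
  by move=> z /spX[t -> /andP[t1 th]] /=; apply: affine_le_expR_powR.
- rewrite -rdotZr -rdotDr.
  apply: (cfc_form_le dot_norm sX hW (addR _ _ _ _ hP (scaleR _ _ _ hX))).
  by move=> z /spX[t -> /andP[t1 th]] /=; apply: affine_le_powR_add.
Qed.

End GeometricMean.

End OperatorPowers.

Theorem theorem2p3 (R : realType) (H : completeNormedModType R[i])
    (dot : {dot H for Num.conj})
    (dot_norm : forall x : H, dot x x = `|x| ^+ 2)
    (l m M : R) (A B : H -> H)
    (l01 : 0 <= l <= 1) (m_gt0 : 0 < m)
    (A_pos : positive_operator dot A) (A_inv : invertible A)
    (B_pos : positive_operator dot B) (B_inv : invertible B)
    (mA : op_le dot (m%:C *: idfun) A) (AB : op_le dot A B)
    (BM : op_le dot B (M%:C *: idfun)) (M1 : op_le dot (M%:C *: idfun) idfun) :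
  let h := M / m in
  let AM := (1 - l)%:C *: A + l%:C *: B in
  let GM := geometric_mean l A B in
  (op_le dot GM AM /\
   op_le dot AM ((expR (l * (1 - l) * (1 - h) ^+ 2))%:C *: GM)) /\
  (op_le dot GM AM /\
   op_le dot AM (GM + (l * (1 - l) * ln h ^+ 2)%:C *: B)).
Proof.
move=> h AM GM.
have [x0|x0] := pselect (exists x : H, x != 0); last first.
  have triv (x : H) : x = 0 by apply: contrapT => xn; apply: x0; exists x; exact/eqP.
  by split; split; exact: positive_operator_trivial.
have sA := A_pos.1; have sB := B_pos.1.
have [sG form] := geometric_mean_form_bounds dot_norm l01 m_gt0 sA sB mA AB BM x0.
have sAM : selfadjoint dot AM.
  by apply: selfadjoint_add; exact: selfadjoint_scale.
have le1 : op_le dot GM AM.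
  by apply/op_leP => // x; have [] := form x.
split; split=> //; apply/op_leP => //.
- exact: selfadjoint_scale.
- by move=> x; rewrite opE rdotZr; have [] := form x.
- by apply: selfadjoint_add => //; exact: selfadjoint_scale.
- by move=> x; rewrite !opE rdotDr rdotZr; have [] := form x.
Qed.
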